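(* Let $\Gamma$ be a finite vertex-transitive graph with vertex set $V\Gamma=[m]\times[k]$ and let $G\le\mathrm{Aut}(\Gamma)$ satisfy $X^k\le G\le Y\wr\mathrm{Sym}(k)$, where $(m,X,Y)$ is one of ($m\ge4$, $\mathrm{Alt}(m)$, $\mathrm{Sym}(m)$), ($5$, $D_5$, $\mathrm{AGL}_1(5)$), ($6$, $\mathrm{PSL}_2(5)$, $\mathrm{PGL}_2(5)$), ($7$, $\mathrm{PGL}_3(2)$, $\mathrm{PGL}_3(2)$), ($8$, $\mathrm{AGL}_3(2)$, $\mathrm{AGL}_3(2)$). Then either (1) $\mu(\Gamma)=2$ and $\Gamma\cong\Theta[K_m]$ or $\Gamma\cong\Theta[mK_1]$ for a vertex-transitive graph $\Theta$; or (2) $\mu(\Gamma)=4$ and $\Gamma\cong\Theta[C_5]$ for a vertex-transitive graph $\Theta$.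
   Context: Graphs are finite, simple, undirected; $\mu(\Gamma)$ is the minimum number of vertices moved by a non-identity automorphism. $[k]=\{1,\dots,k\}$. $Y\wr\mathrm{Sym}(k)=Y^k\rtimes\mathrm{Sym}(k)$ acts on $[m]\times[k]$ by $(\delta,j)^{((y_1,\dots,y_k),h)}=(\delta^{y_j},j^h)$, and $X^k=\{((x_1,\dots,x_k),1):x_j\in X\}$. The groups act on $[m]$ identified with: $5$ points for $D_5$ (dihedral of order $10$) and $\mathrm{AGL}_1(5)$ (on $\mathbb F_5$); the projective line over $\mathbb F_5$ for $\mathrm{PSL}_2(5)\le\mathrm{PGL}_2(5)$; the Fano plane's points for $\mathrm{PGL}_3(2)$; $\mathbb F_2^3$ for $\mathrm{AGL}_3(2)$. The lexicographic product $\Theta[\Delta]$ has vertex set $V\Delta\times V\Theta$, with $(\delta_1,\theta_1)\sim(\delta_2,\theta_2)$ iff ($\theta_1=\theta_2$ and $\delta_1\sim\delta_2$) or $\theta_1\sim\theta_2$. $K_m$ complete graph, $mK_1$ edgeless graph on $m$ vertices, $C_5$ the $5$-cycle. *)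

(* Defs.v *)
From HB Require Import structures.
From mathcomp Require Import all_boot all_order all_algebra all_fingroup all_solvable.

Set Implicit Arguments.
Unset Strict Implicit.
Unset Printing Implicit Defensive.

Import GRing.Theory.

Record sgraph (V : finType) := SGraph {
  adj :> rel V;
  adj_sym : symmetric adj;
  adj_irr : irreflexive adj
}.

Definition graph_aut (V : finType) (Gamma : sgraph V) : {set {perm V}} :=
  [set g : {perm V} | [forall x, forall y, Gamma (g x) (g y) == Gamma x y]].

(* MathComp's transitivity requires a nonempty set, so the null graph is not
   vertex-transitive. *)
Definition vertex_transitive (V : finType) (Gamma : sgraph V) : Prop :=
  [transitive graph_aut Gamma, on [set: V] | 'P].

Definition graph_iso (V W : finType) (Gamma : sgraph V) (Delta : sgraph W) : Prop :=
  exists2 f : V -> W, bijective f & forall x y, Delta (f x) (f y) = Gamma x y.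

Definition moved (V : finType) (g : {perm V}) : {set V} := [set x | g x != x].

(* mu(Gamma) = n.  A relation, because mu is undefined when the only
   automorphism is the identity. *)
Definition mu_is (V : finType) (Gamma : sgraph V) (n : nat) : Prop :=
  (exists g : {perm V}, [/\ g \in graph_aut Gamma, g != 1%g & #|moved g| = n]) /\
  (forall g : {perm V}, g \in graph_aut Gamma -> g != 1%g -> n <= #|moved g|).

Definition complete_rel (m : nat) : rel 'I_m := fun x y => x != y.
Lemma complete_sym m : symmetric (@complete_rel m).
Proof. by move=> x y; rewrite /complete_rel eq_sym. Qed.
Lemma complete_irr m : irreflexive (@complete_rel m).
Proof. by move=> x; rewrite /complete_rel eqxx. Qed.
Definition complete_graph m : sgraph 'I_m := SGraph (@complete_sym m) (@complete_irr m).

Definition edgeless_rel (m : nat) : rel 'I_m := fun _ _ => false.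
Lemma edgeless_sym m : symmetric (@edgeless_rel m). Proof. by []. Qed.
Lemma edgeless_irr m : irreflexive (@edgeless_rel m). Proof. by []. Qed.
Definition edgeless_graph m : sgraph 'I_m := SGraph (@edgeless_sym m) (@edgeless_irr m).

Definition C5_rel : rel 'Z_5 := fun x y => (y == x + 1)%R || (x == y + 1)%R.
Lemma C5_sym : symmetric C5_rel.
Proof. by move=> x y; rewrite /C5_rel orbC. Qed.
Lemma C5_irr : irreflexive C5_rel.
Proof. by move=> x; rewrite /C5_rel orbb -[X in X == _]addr0 (inj_eq (addrI x)). Qed.
Definition C5 : sgraph 'Z_5 := SGraph C5_sym C5_irr.

Section Lexicographic.
Variables (VTheta VDelta : finType) (Theta : sgraph VTheta) (Delta : sgraph VDelta).

Definition lex_rel : rel (VDelta * VTheta) := fun p q =>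
  ((p.2 == q.2) && Delta p.1 q.1) || Theta p.2 q.2.
Lemma lex_sym : symmetric lex_rel.
Proof. by move=> p q; rewrite /lex_rel eq_sym adj_sym [Theta _ _]adj_sym. Qed.
Lemma lex_irr : irreflexive lex_rel.
Proof. by move=> p; rewrite /lex_rel !adj_irr andbF. Qed.

(* Theta[Delta]: every vertex of Theta is replaced by a copy of Delta. *)
Definition lex_product : sgraph (VDelta * VTheta)%type := SGraph lex_sym lex_irr.
End Lexicographic.

Section Wreath.
Variables (m k : nat).

Definition base_power (X : {set {perm 'I_m}}) : {set {perm ('I_m * 'I_k)}} :=
  [set g : {perm ('I_m * 'I_k)} | [exists x : {ffun 'I_k -> {perm 'I_m}},
     [forall j, x j \in X] && [forall p, g p == (x p.2 p.1, p.2)]]].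

(* The image of Y wr Sym(k) in its imprimitive action on [m] x [k]. *)
Definition wreath_Sym (Y : {set {perm 'I_m}}) : {set {perm ('I_m * 'I_k)}} :=
  [set g : {perm ('I_m * 'I_k)} | [exists y : {ffun 'I_k -> {perm 'I_m}}, exists h : {perm 'I_k},
     [forall j, y j \in Y] && [forall p, g p == (y p.2 p.1, h p.2)]]].
End Wreath.

Section ClassicalGroups.
Local Open Scope ring_scope.

Section Projective.
Variables (F : finFieldType) (n : nat).

Definition is_line (L : {set 'rV[F]_n}) : bool :=
  [exists v : 'rV[F]_n, (v != 0) && (L == [set a *: v | a : F])].

(* The points of the projective space of dimension n - 1 over F. *)
Definition proj_point : finType := {L : {set 'rV[F]_n} | is_line L}.

Definition induced_by (s : {perm proj_point}) (A : 'M[F]_n) : bool :=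
  [forall p, val (s p) == [set v *m A | v in val p]].

Definition PGL : {set {perm proj_point}} :=
  [set s : {perm proj_point} | [exists A : 'M[F]_n, (A \in unitmx) && induced_by s A]].

Definition PSL : {set {perm proj_point}} :=
  [set s : {perm proj_point} | [exists A : 'M[F]_n, (\det A == 1) && induced_by s A]].

Definition AGL : {set {perm 'rV[F]_n}} :=
  [set s : {perm 'rV[F]_n} | [exists A : 'M[F]_n, exists b : 'rV[F]_n,
     (A \in unitmx) && [forall v, s v == v *m A + b]]].
End Projective.

Definition AGL1_5 : {set {perm 'F_5}} :=
  [set s : {perm 'F_5} | [exists a : 'F_5, exists b : 'F_5,
     (a != 0) && [forall x, s x == a * x + b]]].

(* The symmetries of the pentagon with vertices 0, 1, 2, 3, 4 in F_5. *)
Definition D5 : {set {perm 'F_5}} :=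
  [set s : {perm 'F_5} | [exists a : 'F_5, exists b : 'F_5,
     ((a == 1) || (a == -1)) && [forall x, s x == a * x + b]]].
End ClassicalGroups.

Definition pullback (m : nat) (T : finType) (f : 'I_m -> T) (A : {set {perm T}}) :
    {set {perm 'I_m}} :=
  [set s : {perm 'I_m} | [exists t in A, [forall i, f (s i) == t (f i)]]].

(* X and Y correspond to A and B under one common identification of [m] with T. *)
Definition identified (m : nat) (X Y : {set {perm 'I_m}})
    (T : finType) (A B : {set {perm T}}) : Prop :=
  exists f : 'I_m -> T, [/\ bijective f, X = pullback f A & Y = pullback f B].

Inductive admissible (m : nat) (X Y : {set {perm 'I_m}}) : Prop :=
| adm_Alt of 4 <= m & X = ('Alt_('I_m))%g & Y = ('Sym_('I_m))%g
| adm_D5 of m = 5 & identified X Y D5 AGL1_5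
| adm_PSL of m = 6 & identified X Y (PSL 'F_5 2) (PGL 'F_5 2)
| adm_PGL of m = 7 & identified X Y (PGL 'F_2 3) (PGL 'F_2 3)
| adm_AGL of m = 8 & identified X Y (AGL 'F_2 3) (AGL 'F_2 3).

(* Main.v *)
Require Import Defs.
From mathcomp Require Import all_boot all_order all_algebra all_fingroup all_solvable.

(* Since X is transitive, X^k forces the adjacency between two distinct blocks
   [m] x {i} and [m] x {j} to be all or nothing, so Gamma is a lexicographic
   product over the graph Theta of blocks once all blocks induce the same graph.
   An automorphism of Gamma need not permute the blocks, but Hall's theorem
   extracts from it a permutation of the blocks that follows it along one point
   per block, and this permutation is an automorphism of Theta.
   If X is 2-transitive, each block is complete or edgeless, hence consists of
   pairwise twins; all twins of a vertex are adjacent to it or none is, so vertex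
   transitivity makes all blocks of the same kind. For D_5 a block may also be a
   pentagon, whose vertices have no twins, so again there is no mixing. Finally,
   an automorphism moving at most three vertices yields twins, whence mu = 4 in
   the pentagon case. *)

Set Implicit Arguments.
Unset Strict Implicit.
Unset Printing Implicit Defensive.

Import GRing.Theory.

(** * Hall's marriage theorem and permutations of blocks *)

Section Hall.
Variables (A B : finType) (r : A -> B -> bool).

Definition neighbours (E : {set B}) (S : {set A}) : {set B} :=
  [set b in E | [exists a in S, r a b]].

Lemma neighboursP (E : {set B}) (S : {set A}) b :
  reflect (b \in E /\ exists2 a, a \in S & r a b) (b \in neighbours E S).
Proof.
rewrite inE; apply: (iffP andP) => -[bE].
  by case/exists_inP=> a; split=> //; exists a.
by case=> a aS rab; split=> //; apply/exists_inP; exists a.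
Qed.

(** Induction on the size of [D]. If some nonempty proper subset [S] is tight, [S] and its
    complement are matched separately; otherwise one edge is chosen freely. The target set [E] is a
    parameter because the induction shrinks it; [b0] is a default value for empty [D]. *)
Lemma hall_marriage (D : {set A}) (E : {set B}) (b0 : B) :
  (forall S : {set A}, S \subset D -> #|S| <= #|neighbours E S|) ->
  exists f : A -> B, {in D &, injective f} /\
    {in D, forall a, f a \in E /\ r a (f a)}.
Proof.
elim: {D}_.+1 {-2}D (ltnSn #|D|) E => // n IHn D leDn E hallD.
have [[S /and4P[S0 SD SnD tight]] | no_tight] :=
  altP (@existsP _ (fun S : {set A} =>
    [&& S != set0, S \subset D, S != D & #|neighbours E S| <= #|S|])).
  have SltD : #|S| < #|D| by apply: proper_card; rewrite properEneq SnD.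
  have [f [finj fE]] : exists f : A -> B, {in S &, injective f} /\
      {in S, forall a, f a \in E /\ r a (f a)}.
    apply: IHn; first exact: leq_trans SltD leDn.
    by move=> S' S'S; apply: hallD; apply: subset_trans S'S SD.
  have [g [ginj gE]] : exists g : A -> B, {in D :\: S &, injective g} /\
      {in D :\: S, forall a, g a \in E :\: neighbours E S /\ r a (g a)}.
    apply: IHn => [|S' S'DS].
      rewrite cardsD (setIidPr SD) -ltnS; apply: leq_trans leDn.
      by rewrite ltnS ltn_subrL card_gt0 S0 (leq_ltn_trans _ SltD).
    have dis : [disjoint S' & S].
      by move: S'DS; rewrite subsetD => /andP[].
    have S'D : S' \subset D by move: S'DS; rewrite subsetD => /andP[].
    (* Hall's condition for [S' :|: S], minus the at most [#|S|] neighbours of the tight set [S],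
       leaves at least [#|S'|] neighbours of [S'] outside [neighbours E S]. *)
    have := hallD (S' :|: S); rewrite subUset S'D SD => /(_ isT).
    have -> : #|S' :|: S| = #|S'| + #|S|.
      by apply/eqP; rewrite (leq_card_setU S' S).2.
    move=> leU; rewrite -(leq_add2r #|S|); apply: leq_trans leU _.
    have sub : neighbours E (S' :|: S) \subset
        neighbours (E :\: neighbours E S) S' :|: neighbours E S.
      apply/subsetP=> b /neighboursP[bE [a aSS rab]]; rewrite in_setU.
      have [|bNS] /= := boolP (b \in neighbours E S); first by rewrite orbT.
      rewrite orbF; apply/neighboursP; split; first by rewrite inE bNS bE.
      exists a => //; case/setUP: aSS => // aS.
      by case/negP: bNS; apply/neighboursP; split=> //; exists a.
    apply: leq_trans (subset_leq_card sub) _.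
    by apply: leq_trans (leq_card_setU _ _) _; rewrite leq_add2l.
  have gDS a : a \in D -> a \notin S -> a \in D :\: S by move=> aD aS; rewrite inE aS.
  have fNS a : a \in S -> f a \in neighbours E S.
    by move=> aS; have [fa ra] := fE a aS; apply/neighboursP; split=> //; exists a.
  exists (fun a => if a \in S then f a else g a); split=> [a b aD bD|a aD].
    case: ifPn => aS; case: ifPn => bS; [exact: finj| | |exact: (ginj _ _ (gDS a aD aS) (gDS b bD bS))].
      by move=> e; have [] := gE b (gDS b bD bS); rewrite -e inE fNS.
    by move=> e; have [] := gE a (gDS a aD aS); rewrite e inE fNS.
  case: ifPn => aS; first exact: fE.
  by have [] := gE a (gDS a aD aS); rewrite inE => /andP[].
have [D0 | [a0 a0D]] := set_0Vmem D.
  by exists (fun=> b0); split=> [a|a]; rewrite D0 inE.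
(* Without a tight subset, [a0] may take any neighbour [b]: each nonempty proper subset of [D] has a
   neighbour to spare, so deleting [b] preserves Hall's condition. *)
have /hallD : [set a0] \subset D by rewrite sub1set.
rewrite cards1 card_gt0 => /set0Pn[b /neighboursP[bE [_ /set1P-> rab]]].
have [f [finj fE]] : exists f : A -> B, {in D :\ a0 &, injective f} /\
    {in D :\ a0, forall a, f a \in E :\ b /\ r a (f a)}.
  apply: IHn => [|S S_Da]; first by move: leDn; rewrite (cardsD1 a0) a0D.
  have [-> | S0] := eqVneq S set0; first by rewrite cards0.
  move: S_Da; rewrite subsetD1 => /andP[SD aS].
  have ltS : #|S| < #|neighbours E S|.
    rewrite ltnNge; apply/negP=> tight; case/existsP: no_tight; exists S.
    by rewrite S0 SD tight andbT; apply: contraNneq aS => ->.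
  rewrite -ltnS; apply: leq_trans ltS _; rewrite (cardsD1 b).
  apply: leq_trans (leq_add (leq_b1 _) (leqnn _)) _; rewrite add1n ltnS.
  apply/subset_leq_card/subsetP=> c /setD1P[cb /neighboursP[cE Hc]].
  by apply/neighboursP; split=> //; rewrite !inE cb.
exists (fun a => if a == a0 then b else f a); split=> [a c aD cD|a aD].
  case: eqP => [->|/eqP na]; case: eqP => [->|/eqP nc] // e.
  - have [|] := fE c; first by rewrite !inE nc.
    by rewrite -e !inE eqxx.
  - have [|] := fE a; first by rewrite !inE na.
    by rewrite e !inE eqxx.
  - by apply: finj; rewrite ?inE ?na ?nc.
case: eqP => [->|/eqP na] //.
by have [|] := fE a; [rewrite !inE na | rewrite inE => /andP[]].
Qed.
End Hall.

(* Removing the edge [i0 -> j0] keeps Hall's condition, because the point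
   [(b, j0)] is not hit from any other block. *)
Lemma perm_of_blocks (m k : nat) (g : {perm 'I_m * 'I_k}) (a b : 'I_m) (i0 j0 : 'I_k) :
  g (a, i0) = (b, j0) ->
  exists2 p : {perm 'I_k}, p i0 = j0 & forall i, exists c, (g (c, i)).2 = p i.
Proof.
move=> gab; pose r (i j : 'I_k) := [exists c, (g (c, i)).2 == j].
have [|f [finj fE]] := @hall_marriage _ _ r (~: [set i0]) (~: [set j0]) j0.
  move=> S; rewrite subsetC sub1set inE => iS; set N := neighbours _ _ _.
  (* Points are counted instead of blocks: [g] maps the [m * #|S|] points over [S] into the blocks
     of [j0 |: N], and missing [(b, j0)] makes the inequality strict. *)
  rewrite -ltnS -(ltn_pmul2l (leq_ltn_trans (leq0n a) (ltn_ord a))).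
  have -> : m * #|S| = #|g @: setX [set: 'I_m] S|.
    by rewrite card_imset ?cardsX ?cardsT ?card_ord //; apply: perm_inj.
  have -> : m * #|N|.+1 = #|setX [set: 'I_m] (j0 |: N)|.
    rewrite cardsX cardsT card_ord cardsU1.
    by rewrite [j0 \in N]inE in_setC set11.
  apply: proper_card; apply/properP; split.
    apply/subsetP=> _ /imsetP[[c i] /setXP[_ iS'] ->].
    rewrite !inE /=; case: eqP => //= _.
    apply/exists_inP; exists i => //; apply/existsP; by exists c.
  exists (b, j0); first by rewrite !inE eqxx.
  apply/imsetP=> -[[c i] /setXP[_ iS']]; rewrite -gab => /perm_inj[_ e].
  by rewrite e iS' in iS.
pose h i := if i == i0 then j0 else f i.
have hinj : injective h.
  have inD i : i != i0 -> i \in ~: [set i0] by rewrite !inE.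
  move=> i j; rewrite /h; case: eqP => [->|/eqP ni]; case: eqP => [->|/eqP nj] // e.
  - by have [] := fE j (inD j nj); rewrite -e !inE eqxx.
  - by have [] := fE i (inD i ni); rewrite e !inE eqxx.
  - by apply: finj; rewrite ?inD.
exists (perm hinj) => [|i]; first by rewrite permE /h eqxx.
rewrite permE /h; case: eqP => [->|/eqP ni]; first by exists a; rewrite gab.
by have [|_ /existsP[c /eqP]] := fE i; [rewrite !inE | exists c].
Qed.

(** * Twins and automorphisms of small support *)

Section Twins.
Variables (V : finType) (Gamma : sgraph V).

(** Covers adjacent and non-adjacent twins at once, since nothing is said about [Gamma u v]. *)
Definition twins (u v : V) : Prop :=
  u != v /\ forall x, x != u -> x != v -> Gamma x u = Gamma x v.

Lemma graph_autP (g : {perm V}) :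
  reflect (forall x y, Gamma (g x) (g y) = Gamma x y) (g \in graph_aut Gamma).
Proof.
rewrite inE; apply: (iffP forallP) => [H x y | H x].
  by move/forallP: (H x) => /(_ y)/eqP.
by apply/forallP=> y; rewrite H.
Qed.

(** For [v != w] both sides equal [Gamma v w]: [v] does not separate [u] from [w], and [w] does not
    separate [u] from [v]. This later excludes a mixture of complete and edgeless blocks. *)
Lemma twins_adj_eq u v w : twins u v -> twins u w -> Gamma u v = Gamma u w.
Proof.
move=> [uv tv] [uw tw]; have [-> // | vw] := eqVneq v w.
rewrite [LHS]adj_sym [RHS]adj_sym tw // 1?eq_sym //.
by rewrite [RHS]tv 1?[RHS]adj_sym // eq_sym.
Qed.

Lemma twins_aut g u v : g \in graph_aut Gamma -> twins u v -> twins (g u) (g v).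
Proof.
move=> /graph_autP gA [uv tv]; split; first by rewrite (inj_eq perm_inj).
move=> x; rewrite -[x](permKV g) !(inj_eq perm_inj) !gA; exact: tv.
Qed.

Lemma tperm_twins_aut u v : twins u v -> tperm u v \in graph_aut Gamma.
Proof.
move=> [uv tv]; apply/graph_autP => x y.
case: (tpermP u v x) => [->|->|/eqP xu /eqP xv];
  case: (tpermP u v y) => [->|->|/eqP yu /eqP yv]; rewrite ?adj_irr //.
- exact: adj_sym.
- by rewrite ![Gamma _ y]adj_sym tv.
- exact: adj_sym.
- by rewrite ![Gamma _ y]adj_sym tv.
- by rewrite tv.
- by rewrite tv.
Qed.

Lemma moved_gt1 (g : {perm V}) : g != 1%g -> 1 < #|moved g|.
Proof.
move=> g1; have [x gx] : exists x, g x != x.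
  apply/existsP; apply: contraNT g1; rewrite negb_exists => /forallP H.
  by apply/eqP/permP=> x; rewrite perm1; apply/eqP; rewrite -[_ == _]negbK.
rewrite (cardsD1 x) inE gx add1n ltnS card_gt0; apply/set0Pn; exists (g x).
by rewrite !inE gx (inj_eq perm_inj).
Qed.

(* A permutation moving at most three points is a transposition or a 3-cycle;
   a 3-cycle of automorphisms makes its three points pairwise twins. *)
Lemma few_moved_twins (g : {perm V}) : g \in graph_aut Gamma -> g != 1%g ->
  #|moved g| <= 3 -> exists u v, twins u v.
Proof.
move=> /graph_autP gA /moved_gt1 lt1 le3.
have [u] : exists u, u \in moved g by apply/set0Pn; rewrite -card_gt0 ltnW.
rewrite inE => gu; exists u, (g u); split; first by rewrite eq_sym.
move=> x xu xgu; have [gx | gx] := eqVneq (g x) x; first by rewrite -[in RHS]gx gA.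
(* Now [x] is a third moved point, so [u], [g u] and [x] are all of them, and [g] must be the cycle
   from [x] to [u] to [g u] and back to [x]. *)
have M y : g y != y -> [|| y == u, y == g u | y == x].
  have /eqP E : [set u; g u; x] == moved g.
    rewrite eqEcard; apply/andP; split.
      apply/subsetP=> z; rewrite !inE -orbA => /or3P[]/eqP-> //.
      by rewrite (inj_eq perm_inj).
    by rewrite setUC cardsU1 cards2 !inE negb_or xu xgu eq_sym gu.
  move=> gy; have : y \in moved g by rewrite inE.
  by rewrite -E !inE -orbA.
have gx_moved : g (g x) != g x by rewrite (inj_eq perm_inj).
have gxu : g x = u.
  have /or3P[/eqP // | /eqP/perm_inj e | e] := M _ gx_moved.
    by rewrite e eqxx in xu.
  by rewrite e in gx.
have ggu : g (g u) = x.
  have ggu : g (g u) != g u by rewrite (inj_eq perm_inj).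
  have ggg : g (g (g u)) != g (g u) by rewrite (inj_eq perm_inj).
  have /or3P[e | e | /eqP //] := M _ ggg.
  - by move: e; rewrite -{2}gxu => /eqP/perm_inj e; rewrite e eqxx in xgu.
  - by rewrite e in ggu.
by rewrite -{1}ggu -{2}gxu gA adj_sym.
Qed.
End Twins.

Lemma exists_neq (T : finType) (a : T) : 1 < #|T| -> exists b, a != b.
Proof.
move=> T1; apply/existsP; rewrite -negb_forall; apply/negP=> /forallP alla.
have : #|T| <= #|pred1 a| by apply/subset_leq_card/subsetP=> y _; rewrite inE eq_sym.
by rewrite card1 leqNgt T1.
Qed.

Lemma vertex_transitiveP (V : finType) (Gamma : sgraph V) :
  vertex_transitive Gamma <->
  inhabited V /\ forall u v, exists2 g, g \in graph_aut Gamma & g u = v.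
Proof.
split=> [/imsetP[x0 _ E] | [[x0] H]].
  split=> [|u v]; first by split.
  have /imsetP[g1 /graph_autP g1A Eu] : u \in orbit 'P (graph_aut Gamma) x0 by rewrite -E inE.
  have /imsetP[g2 /graph_autP g2A Ev] : v \in orbit 'P (graph_aut Gamma) x0 by rewrite -E inE.
  exists (g1^-1 * g2)%g; last by rewrite permM Eu Ev /= /aperm permK.
  by apply/graph_autP => x y; rewrite !permM g2A -g1A !permKV.
apply/imsetP; exists x0; rewrite ?inE //; apply/eqP; rewrite eqEsubset subsetT andbT.
apply/subsetP=> y _; have [g gA <-] := H x0 y; exact: imset_f.
Qed.

(** * The graph of blocks and the case of homogeneous blocks *)

Section Blocks.
Variables (m k : nat) (X : {set {perm 'I_m}}) (Gamma : sgraph ('I_m * 'I_k)%type).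
Hypothesis XGamma : base_power k X \subset graph_aut Gamma.

Lemma base_power_adj (x : 'I_k -> {perm 'I_m}) : (forall j, x j \in X) ->
  forall a i b j, Gamma (x i a, i) (x j b, j) = Gamma (a, i) (b, j).
Proof.
move=> xX; pose h (p : 'I_m * 'I_k) := (x p.2 p.1, p.2).
have hinj : injective h.
  by move=> [a i] [b j] [/= e1 e2]; move: e1; rewrite e2 => /perm_inj->.
have /(subsetP XGamma)/graph_autP hA : perm hinj \in base_power k X.
  rewrite inE; apply/existsP; exists (finfun x); apply/andP; split.
    by apply/forallP=> j; rewrite ffunE.
  by apply/forallP=> p; rewrite permE ffunE.
by move=> a i b j; have := hA (a, i) (b, j); rewrite !permE.
Qed.

Lemma inner_adj x a b j : x \in X -> Gamma (x a, j) (x b, j) = Gamma (a, j) (b, j).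
Proof. by move=> xX; apply: (@base_power_adj (fun=> x)). Qed.

Hypothesis Xtrans : forall a b, exists2 x, x \in X & x a = b.

(** An element of [X^k] may act as [x] on block [i] and as [y] on all others, which moves the two
    endpoints independently. *)
Lemma outer_adj a b c d i j : i != j -> Gamma (a, i) (b, j) = Gamma (c, i) (d, j).
Proof.
move=> ij; have [x xX <-] := Xtrans a c; have [y yX <-] := Xtrans b d.
have /base_power_adj/(_ a i b j) : forall l, (if l == i then x else y) \in X.
  by move=> l; case: ifP.
by rewrite eqxx eq_sym (negbTE ij).
Qed.

Variable z : 'I_m.

(** The same point [z] represents every block; by [outer_adj] its choice does not affect the
    relation. *)
Definition block_rel : rel 'I_k := fun i j => (i != j) && Gamma (z, i) (z, j).
Lemma block_rel_sym : symmetric block_rel.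
Proof. by move=> i j; rewrite /block_rel eq_sym adj_sym. Qed.
Lemma block_rel_irr : irreflexive block_rel.
Proof. by move=> i; rewrite /block_rel eqxx. Qed.
Definition block_graph : sgraph 'I_k := SGraph block_rel_sym block_rel_irr.

Lemma block_graph_adj a b i j : i != j -> Gamma (a, i) (b, j) = block_graph i j.
Proof. by move=> ij; rewrite /= /block_rel ij; apply: outer_adj. Qed.

(** The permutation [p] follows [g] along one point [c] per block. Adjacency between distinct blocks
    ignores the chosen points, so [p] inherits its preservation from [g]. *)
Lemma block_graph_transitive : vertex_transitive Gamma -> vertex_transitive block_graph.
Proof.
case/vertex_transitiveP=> [[[_ i0]] H]; apply/vertex_transitiveP; split=> [|i j].
  by split.
have [g /graph_autP gA gij] := H (z, i) (z, j).
have [p pij pP] := perm_of_blocks gij; exists p => //.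
apply/graph_autP=> l n; have [-> | ln] := eqVneq l n; first by rewrite !adj_irr.
have pln : p l != p n by rewrite (inj_eq perm_inj).
have [c gc] := pP l; have [d gd] := pP n.
rewrite -(block_graph_adj c d ln) -gA.
case: (g (c, l)) gc => c' _ /= ->; case: (g (d, n)) gd => d' _ /= ->.
by rewrite block_graph_adj.
Qed.

(** The identification [f j] with [Delta] may vary with the block, as pentagons with different
    connection sets require. *)
Lemma block_graph_iso (T : finType) (Delta : sgraph T) (f : 'I_k -> 'I_m -> T) :
  (forall j, bijective (f j)) ->
  (forall j a b, Delta (f j a) (f j b) = Gamma (a, j) (b, j)) ->
  graph_iso Gamma (lex_product block_graph Delta).
Proof.
move=> fbij fadj; exists (fun p => (f p.2 p.1, p.2)).
  apply: inj_card_bij => [[a i] [b j] [/= e1 e2]|].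
    by move: e1; rewrite e2 => /(bij_inj (fbij j))->.
  rewrite !card_prod; have [i _ | k0] := pickP 'I_k.
    by rewrite (bij_eq_card (fbij i)).
  by rewrite [#|'I_k|]eq_card0 ?muln0.
move=> [a i] [b j]; rewrite /= /lex_rel /=; have [-> | ij] := eqVneq i j.
  by rewrite fadj block_rel_irr orbF.
by rewrite (block_graph_adj _ _ ij).
Qed.

(** The block is complete for [e = true] and edgeless for [e = false]. *)
Definition homogeneous j := exists e, forall a b, a != b -> Gamma (a, j) (b, j) = e.

Lemma homogeneous_twins j a b : homogeneous j -> a != b -> twins Gamma (a, j) (b, j).
Proof.
case=> e eP ab; split=> [|[c l]]; first by rewrite xpair_eqE eqxx andbT.
rewrite !xpair_eqE; have [-> | lj] := eqVneq l j; last by move=> _ _; apply: outer_adj.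
by rewrite !andbT => ca cb; rewrite !eP.
Qed.

Lemma homogeneous_case : 1 < m -> vertex_transitive Gamma ->
  (forall j, homogeneous j) ->
  mu_is Gamma 2 /\ exists (W : finType) (Theta : sgraph W), vertex_transitive Theta /\
    (graph_iso Gamma (lex_product Theta (complete_graph m)) \/
     graph_iso Gamma (lex_product Theta (edgeless_graph m))).
Proof.
move=> m1 Gtrans hom; have [z' zz'] : exists z', z != z'.
  by apply: exists_neq; rewrite card_ord.
have /vertex_transitiveP[[[_ j0]] Gt] := Gtrans.
have tw j := homogeneous_twins (hom j) zz'; split.
  split=> [|g _]; last exact: moved_gt1.
  exists (tperm (z, j0) (z', j0)); split; first exact: (tperm_twins_aut (tw j0)).
    have [ne _] := tw j0.
    by apply: contraNneq ne => E; have := tpermL (z, j0) (z', j0); rewrite E perm1 => ->.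
  have [ne _] := tw j0; have -> : moved (tperm (z, j0) (z', j0)) = [set (z, j0); (z', j0)].
    apply/setP=> x; rewrite !inE; case: tpermP => [->|->|/eqP/negbTE-> /eqP/negbTE->];
    by rewrite ?eqxx ?orbT // ?[_ == (z, j0)]eq_sym ?ne.
  by rewrite cards2 ne.
(* All blocks are of one kind: [g] carries [(z', j0)] to a twin of [(z, j)], possibly outside block
   [j], and [twins_adj_eq] compares this twin with [(z', j)]. *)
have adj_z j : Gamma (z, j) (z', j) = Gamma (z, j0) (z', j0).
  have [g gA gz] := Gt (z, j0) (z, j).
  have tg : twins Gamma (z, j) (g (z', j0)) by rewrite -gz; apply: twins_aut gA (tw j0).
  by rewrite (twins_adj_eq (tw j) tg) -gz; move/graph_autP: gA => ->.
have adj_in j a b : a != b -> Gamma (a, j) (b, j) = Gamma (z, j0) (z', j0).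
  by move=> ab; rewrite -(adj_z j); case: (hom j) => e eP; rewrite !eP.
exists 'I_k, block_graph; split; first exact: block_graph_transitive.
have idbij : bijective (id : 'I_m -> 'I_m) by exists id.
case E : (Gamma (z, j0) (z', j0)) adj_in => adj_in; [left | right];
  apply: (block_graph_iso (f := fun=> id)) => // j a b /=;
  by have [-> | ab] := eqVneq a b; rewrite ?adj_irr ?adj_in // /complete_rel ?eqxx.
Qed.
End Blocks.

(** * Two-transitivity of the alternating, affine and projective groups *)

Definition two_transitive (T : finType) (A : {set {perm T}}) : Prop :=
  forall a b c d, a != b -> c != d -> exists2 t, t \in A & t a = c /\ t b = d.

Lemma pullbackP m (T : finType) (f : 'I_m -> T) (A : {set {perm T}}) (t : {perm T}) :
  bijective f -> t \in A ->
  exists2 s, s \in pullback f A & forall i, f (s i) = t (f i).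
Proof.
case=> g fK gK tA; have sinj : injective (fun i => g (t (f i))).
  by move=> i j /(can_inj gK)/perm_inj/(can_inj fK).
exists (perm sinj) => [|i]; last by rewrite permE gK.
by rewrite inE; apply/exists_inP; exists t => //; apply/forallP=> i; rewrite permE gK.
Qed.

Lemma two_transitive_pullback m (T : finType) (f : 'I_m -> T) (A : {set {perm T}}) :
  bijective f -> two_transitive A -> two_transitive (pullback f A).
Proof.
move=> fbij tA a b c d ab cd; have finj := bij_inj fbij.
have [||t tA' [ta tb]] := tA (f a) (f b) (f c) (f d); rewrite ?(inj_eq finj) //.
have [s sX sE] := pullbackP fbij tA'; exists s => //.
by split; apply: finj; rewrite sE.
Qed.

(** The alternating group is [(m - 2)]-transitive, and [m - 2] is at least 2. *)
Lemma two_transitive_Alt m : 4 <= m -> two_transitive ('Alt_('I_m))%g.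
Proof.
move=> m4 a b c d ab cd.
have tr : [transitive^2 'Alt_('I_m), on [set: 'I_m] | 'P]%g.
  by apply: ntransitive_weak (Alt_trans _); rewrite card_ord -!subn1 !ltn_subRL.
have dt (x y : 'I_m) : x != y -> [tuple x; y] \in dtuple_on 2 [set: 'I_m].
  by move=> xy; rewrite inE /= inE xy subset_all /= !inE.
have [t tA /(congr1 val)[-> ->]] := atransP2 tr (dt a b ab) (dt c d cd).
by exists t.
Qed.

Section LinearGroups.
Local Open Scope ring_scope.
Variables (F : finFieldType) (n : nat).

(** An invertible [A] takes the nonzero vector [b - a] to [d - c]; a translation then takes the
    image of [a] to [c]. *)
Lemma two_transitive_AGL : two_transitive (AGL F n).
Proof.
move=> a b c d ab cd.
have ab0 : b - a != 0 by rewrite subr_eq0 eq_sym.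
have cd0 : d - c != 0 by rewrite subr_eq0 eq_sym.
have rk (v : 'rV[F]_n) : v != 0 -> row_free v by move=> v0; rewrite /row_free rank_rV v0.
(* The matrix [pinvmx (b - a) *m (d - c)] is singular in general; [complete_unitmx] replaces it by
   an invertible one with the same value at [b - a]. *)
have E : (b - a) *m (pinvmx (b - a) *m (d - c)) = d - c.
  by rewrite mulmxA mulmxVp ?mul1mx ?rk.
have [|A Au /esym Aab] := @complete_unitmx _ _ _ (b - a) (pinvmx (b - a) *m (d - c)).
  by rewrite E !rank_rV ab0 cd0.
rewrite E in Aab; pose h (v : 'rV[F]_n) := v *m A + (c - a *m A).
have hinj : injective h by move=> u v /addIr/(can_inj (mulmxK Au)).
exists (perm hinj).
  rewrite inE; apply/existsP; exists A; apply/existsP; exists (c - a *m A).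
  by rewrite Au; apply/forallP=> v; rewrite permE.
rewrite !permE /h; split; first by rewrite addrC subrK.
by rewrite addrCA -mulmxBl Aab addrC subrK.
Qed.

Lemma proj_point_gen (p : proj_point F n) :
  exists2 v : 'rV[F]_n, v != 0 & val p = [set a *: v | a : F].
Proof. by case: p => L /= /existsP[v /andP[v0 /eqP->]]; exists v. Qed.

Lemma span_rV_scale (v : 'rV[F]_n) (c : F) : c != 0 ->
  [set a *: (c *: v) | a : F] = [set a *: v | a : F].
Proof.
move=> c0; apply/setP=> w; apply/imsetP/imsetP=> -[a _ ->].
  by exists (a * c); rewrite ?scalerA.
by exists (a / c); rewrite ?scalerA ?divfK.
Qed.

Lemma imset_span_rV (v : 'rV[F]_n) (A : 'M[F]_n) :
  [set w *m A | w in [set a *: v | a : F]] = [set a *: (v *m A) | a : F].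
Proof.
rewrite -imset_comp; apply: eq_imset => a /=; by rewrite /= scalemxAl.
Qed.

Lemma induced_by_unit (A : 'M[F]_n) : A \in unitmx ->
  exists s : {perm proj_point F n}, induced_by s A.
Proof.
move=> Au; have lineA (p : proj_point F n) : is_line [set w *m A | w in val p].
  have [v v0 ->] := proj_point_gen p; apply/existsP; exists (v *m A).
  rewrite imset_span_rV eqxx andbT; apply: contraNneq v0 => vA.
  by rewrite -(mulmxK Au v) vA mul0mx.
pose h (p : proj_point F n) : proj_point F n :=
    exist (fun L => is_line L) _ (lineA p).
have hinj : injective h.
  move=> p q /(congr1 val) /= /(imset_inj (can_inj (mulmxK Au))) e; exact: val_inj.
by exists (perm hinj); apply/forallP=> p; rewrite permE.
Qed.

(** A dependency with nonzero coefficient at [w] would make [w] a multiple of [v], and the two lines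
    would coincide. *)
Lemma distinct_points_free (p q : proj_point F n) (v w : 'rV[F]_n) :
  v != 0 -> w != 0 -> p != q ->
  val p = [set a *: v | a : F] -> val q = [set a *: w | a : F] ->
  row_free (col_mx v w).
Proof.
move=> v0 w0 pq pv qw; apply: inj_row_free => u.
rewrite -[u]hsubmxK mul_row_col [lsubmx u]mx11_scalar [rsubmx u]mx11_scalar !mul_scalar_mx.
move: (lsubmx u 0 0) (rsubmx u 0 0) => x y e.
have y0 : y = 0.
  apply/eqP/negPn/negP=> y0; case/eqP: pq; apply: val_inj; rewrite pv qw.
  have wE : w = (- (y^-1 * x)) *: v.
    move/(congr1 (fun t => y^-1 *: t)): e.
    by rewrite scalerDr scaler0 !scalerA mulVf // scale1r addrC => /eqP;
       rewrite addr_eq0 -scaleNr => /eqP.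
  rewrite [in RHS]wE span_rV_scale //; apply: contraNneq w0 => c0.
  by rewrite wE c0 scale0r.
move: e; rewrite y0 scale0r addr0 => /eqP; rewrite scaler_eq0 (negbTE v0) orbF => /eqP->.
by rewrite !raddf0 row_mx0.
Qed.

(* Rescaling a target vector does not change its line: the factor [l] gives [PSL]
   the freedom to normalise determinants. *)
Lemma two_transitive_induced (R : pred 'M[F]_n) (A : {set {perm proj_point F n}}) :
  (forall M s, R M -> induced_by s M -> s \in A) ->
  (forall M, R M -> M \in unitmx) ->
  (forall U V : 'M[F]_(1 + 1, n), row_free U -> row_free V ->
    exists2 M, R M & exists2 l, l != 0 & U *m M = col_mx (l *: usubmx V) (dsubmx V)) ->
  two_transitive A.
Proof.
move=> RA Ru Rtr a b c d ab cd.
have [va va0 Ea] := proj_point_gen a; have [vb vb0 Eb] := proj_point_gen b.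
have [vc vc0 Ec] := proj_point_gen c; have [vd vd0 Ed] := proj_point_gen d.
have [||M RM [l l0]] := Rtr (col_mx va vb) (col_mx vc vd).
- exact: distinct_points_free ab Ea Eb.
- exact: distinct_points_free cd Ec Ed.
rewrite mul_col_mx col_mxKu col_mxKd => /eq_col_mx[Ma Mb].
have [s sM] := induced_by_unit (Ru M RM); exists s; first exact: RA sM.
move/forallP: sM => sM; split; apply: val_inj; rewrite (eqP (sM _)).
  by rewrite Ea imset_span_rV Ma span_rV_scale.
by rewrite Eb imset_span_rV Mb.
Qed.

Lemma two_transitive_PGL : two_transitive (PGL F n).
Proof.
apply: (@two_transitive_induced (fun M => M \in unitmx)) => // [M s Mu sM | U V Uf Vf].
  by rewrite inE; apply/existsP; exists M; rewrite Mu.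
have E : U *m (pinvmx U *m V) = V by rewrite mulmxA mulmxVp ?mul1mx.
have [|M Mu UM] := @complete_unitmx _ _ _ U (pinvmx U *m V).
  by rewrite E (eqP Uf) (eqP Vf).
exists M => //; exists 1; rewrite ?oner_neq0 // scale1r vsubmxK.
by rewrite -[RHS]E.
Qed.
End LinearGroups.

Section ProjectiveLine.
Local Open Scope ring_scope.

Lemma two_transitive_PSL2 (F : finFieldType) : two_transitive (PSL F 2).
Proof.
apply: (@two_transitive_induced _ _ (fun M => \det M == 1)) => [M s Mu sM | M /eqP M1 | U V Uf Vf].
- by rewrite inE; apply/existsP; exists M; rewrite Mu.
- by rewrite unitmxE M1 unitr1.
rewrite row_free_unit in Uf; rewrite row_free_unit in Vf.
have U0 : \det U != 0 by rewrite -unitfE -unitmxE.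
have V0 : \det V != 0 by rewrite -unitfE -unitmxE.
(* In dimension two [U] and [V] are square. Scaling the first row of [V] by [l] gives it the
   determinant of [U], so the change of basis has determinant 1. *)
pose l := \det U / \det V; pose D : 'M[F]_(1 + 1) := block_mx l%:M 0 0 1%:M.
exists (invmx U *m (D *m V)); last first.
  exists l; first by rewrite mulf_neq0 ?invr_eq0.
  rewrite mulKVmx // -{1}[V]vsubmxK mul_block_col !mul0mx addr0 add0r mul1mx.
  by rewrite mul_scalar_mx.
have detD : \det D = l by rewrite det_ublock det1 mulr1 det_scalar1.
by rewrite !det_mulmx det_inv detD divfK // mulVf.
Qed.
End ProjectiveLine.

(** * Blocks acted on by the dihedral group of order 10 *)

Section Pentagon.
Local Open Scope ring_scope.

(** Residues are written with signs so that [connectionN] reduces every nonzero one to 1 or 2. *)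
Lemma F5_cases (d : 'F_5) (P : 'F_5 -> Prop) :
  P 0 -> P 1 -> P 2 -> P (-2) -> P (-1) -> P d.
Proof.
have : d \in [:: 0; 1; 2; -2; -1] by case: d => [[|[|[|[|[|]]]]] lt5].
by rewrite !inE => /or4P[/eqP->|/eqP->|/eqP->|/orP[]/eqP->].
Qed.

(** The vertex type ['Z_5] of the pentagon is convertible to ['F_5]. *)
Lemma C5_relE (x y : 'F_5) : C5_rel x y = (y - x == 1) || (y - x == -1).
Proof.
by rewrite /C5_rel -[y - x == -1]eqr_opp opprB opprK !subr_eq ![1 + _]addrC.
Qed.

Lemma D5_affine (a b : 'F_5) : (a == 1) || (a == -1) ->
  exists2 t, t \in D5 & forall x, t x = a * x + b.
Proof.
move=> a1; have a0 : a != 0 by case/orP: a1 => /eqP->.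
have hinj : injective (fun x => a * x + b) by move=> x y /addIr/(mulfI a0).
exists (perm hinj) => [|x]; last by rewrite permE.
rewrite inE; apply/existsP; exists a; apply/existsP; exists b.
by rewrite a1; apply/forallP=> x; rewrite permE.
Qed.

Variables (m k : nat) (f : 'I_m -> 'F_5) (g : 'F_5 -> 'I_m).
Variable Gamma : sgraph ('I_m * 'I_k)%type.
Hypotheses (fK : cancel f g) (gK : cancel g f).
Hypothesis XGamma : base_power k (pullback f D5) \subset graph_aut Gamma.

Let fbij : bijective f. Proof. by exists g. Qed.

Lemma pullback_D5_affine (a b : 'F_5) : (a == 1) || (a == -1) ->
  exists2 s, s \in pullback f D5 & forall x, f (s x) = a * f x + b.
Proof.
move=> /(D5_affine b)[t tD tE]; have [s sX sE] := pullbackP fbij tD.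
by exists s => // x; rewrite sE tE.
Qed.

Lemma pullback_D5_trans a b : exists2 x, x \in pullback f D5 & x a = b.
Proof.
have [|s sX sE] := @pullback_D5_affine 1 (f b - f a); first by rewrite eqxx.
by exists s => //; apply: (can_inj fK); rewrite sE mul1r addrC subrK.
Qed.

(** Translations make each block a Cayley graph on the additive group of ['F_5]; this is the
    indicator of its connection set. *)
Definition connection j (d : 'F_5) := Gamma (g 0, j) (g d, j).

Lemma connectionE a b j : Gamma (a, j) (b, j) = connection j (f b - f a).
Proof.
have [|s sX sE] := @pullback_D5_affine 1 (- f a); first by rewrite eqxx.
rewrite /connection -(inner_adj XGamma a b j sX).
have -> : s a = g 0 by apply: (can_inj fK); rewrite sE gK mul1r subrr.
by have -> : s b = g (f b - f a) by apply: (can_inj fK); rewrite sE gK mul1r.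
Qed.

Lemma connectionN j d : connection j (- d) = connection j d.
Proof. by rewrite {2}/connection adj_sym connectionE !gK sub0r. Qed.

Lemma connection0 j : connection j 0 = false.
Proof. exact: adj_irr. Qed.

(** The connection set is closed under negation, so its values at 1 and 2 determine it. *)
Lemma homogeneous_or_pentagon j :
  homogeneous Gamma j \/ connection j 2 = ~~ connection j 1.
Proof.
have [e | e] := eqVneq (connection j 2) (connection j 1); [left | right].
  exists (connection j 1) => a b ab; rewrite connectionE.
  have : f b - f a != 0 by rewrite subr_eq0 (inj_eq (can_inj fK)) eq_sym.
  by elim/F5_cases: (f b - f a); rewrite ?eqxx ?connectionN.
by move: e; case: (connection j 2) (connection j 1) => [] [].
Qed.

Lemma pentagon_no_twins j u v :
  connection j 2 = ~~ connection j 1 -> u.2 = j -> ~ twins Gamma u v.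
Proof.
case: u v => [a i] [b l] /= cj -> {i} [uv tw].
have adj_a (d : 'F_5) : Gamma (g (f a + d), j) (a, j) = connection j d.
  by rewrite connectionE gK opprD addrA subrr sub0r connectionN.
have [lj | lj] := eqVneq l j; last first.
  (* A twin in another block is joined to all of block [j] or to none of it, so [connection j] would
     be constant away from 0. *)
  have adj_b (d : 'F_5) : d != 0 -> connection j d = Gamma (a, j) (b, l).
    move=> d0; rewrite -adj_a tw.
    - by apply: (outer_adj XGamma pullback_D5_trans); rewrite eq_sym.
    - rewrite xpair_eqE eqxx andbT -(inj_eq (can_inj fK)) gK.
      by rewrite -subr_eq0 addrC addKr.
    - by rewrite xpair_eqE [j == l]eq_sym (negbTE lj) andbF.
  by have := cj; rewrite !adj_b //; case: (Gamma _ _).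
rewrite lj in uv tw.
have shift (d : 'F_5) : d != 0 -> d != f b - f a -> connection j d = connection j (d - (f b - f a)).
  move=> d0 db; rewrite -adj_a tw.
  - rewrite connectionE gK -connectionN; congr connection.
    by rewrite !opprB addrAC addrC.
  - rewrite xpair_eqE eqxx andbT -(inj_eq (can_inj fK)) gK.
    by rewrite -subr_eq0 addrC addKr.
  - rewrite xpair_eqE eqxx andbT -(inj_eq (can_inj fK)) gK.
    by apply: contra db => /eqP <-; rewrite addrC addKr.
have : f b - f a != 0.
  by apply: contraNneq uv => /eqP; rewrite subr_eq0 (inj_eq (can_inj fK)) => /eqP->.
(* For each difference, [d] is taken as 1 or -1 so that subtracting the difference gives 2 or -2;
   [shift] then equates the values of [connection j] at 1 and 2. *)
elim/F5_cases: (f b - f a) shift => shift // _.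
- have := shift (-1) isT isT; have -> : -1 - 1 = -2 :> 'F_5 by apply: val_inj.
  by rewrite !connectionN cj; case: connection.
- have := shift (-1) isT isT; have -> : -1 - 2 = 2 :> 'F_5 by apply: val_inj.
  by rewrite !connectionN cj; case: connection.
- have := shift 1 isT isT; have -> : 1 - - 2 = -2 :> 'F_5 by apply: val_inj.
  by rewrite !connectionN cj; case: connection.
- have := shift 1 isT isT; have -> : 1 - - 1 = 2 :> 'F_5 by apply: val_inj.
  by rewrite cj; case: connection.
Qed.

(** The reflection negating the coordinate in block [j], extended by the identity, fixes only the
    point with coordinate 0 in that block. *)
Lemma reflection_moves4 (j : 'I_k) :
  exists h, [/\ h \in graph_aut Gamma, h != 1%g & #|moved h| = 4].
Proof.
have [|s sX sE] := @pullback_D5_affine (-1) 0; first by rewrite eqxx orbT.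
(* This is the identity, obtained together with its membership in the pulled back [D5]. *)
have [|e eX eE] := @pullback_D5_affine 1 0; first by rewrite eqxx.
have e1 x : e x = x by apply: (can_inj fK); rewrite eE mul1r addr0.
pose y l := if l == j then s else e.
have yX l : y l \in pullback f D5 by rewrite /y; case: ifP.
pose r (p : 'I_m * 'I_k) := (y p.2 p.1, p.2).
have rinj : injective r.
  by move=> [a i] [b l] [/= e2 e3]; move: e2; rewrite e3 => /perm_inj->.
have mE : moved (perm rinj) = [set (g d, j) | d in [set~ 0]].
  apply/setP=> -[a i]; rewrite inE permE /r /= xpair_eqE eqxx andbT.
  apply/idP/imsetP => [|[d]]; last first.
    rewrite !inE => d0 [-> ->]; rewrite /y eqxx -(inj_eq (can_inj fK)) sE gK.
    by move: d0; elim/F5_cases: d.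
  rewrite /y; have [-> | _] := eqVneq i j; last by rewrite e1 eqxx.
  move=> sa; exists (f a); last by rewrite fK.
  by rewrite !inE; apply: contra sa => /eqP a0; rewrite -(inj_eq (can_inj fK)) sE a0 mulr0 addr0.
have m4 : #|moved (perm rinj)| = 4%N.
  rewrite mE card_imset; last by move=> c d [/(can_inj gK)].
  by rewrite cardsC1 card_Fp.
exists (perm rinj); split=> //.
  apply/graph_autP=> -[a i] [b l]; rewrite !permE; exact: base_power_adj XGamma _ yX _ _ _ _.
apply/eqP=> E; move: m4; rewrite E; suff -> : moved (1 : {perm 'I_m * 'I_k})%g = set0 by rewrite cards0.
by apply/setP=> p; rewrite !inE perm1 eqxx.
Qed.

Lemma pentagon_case : vertex_transitive Gamma ->
  (forall j, connection j 2 = ~~ connection j 1) ->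
  mu_is Gamma 4 /\ exists (W : finType) (Theta : sgraph W), vertex_transitive Theta /\
    graph_iso Gamma (lex_product Theta C5).
Proof.
move=> Gtrans pent; have /vertex_transitiveP[[[_ j0]] _] := Gtrans; split.
  split=> [|h hA h1]; first exact: reflection_moves4 j0.
  rewrite leqNgt; apply/negP => /(few_moved_twins hA h1)[u [v]].
  exact: pentagon_no_twins (pent u.2) _.
have Xt := pullback_D5_trans.
exists 'I_k, (block_graph Gamma (g 0)); split; first exact: block_graph_transitive XGamma Xt _ Gtrans.
(* A connection set {2, -2} is carried to {1, -1} by doubling. *)
pose c j : 'F_5 := if connection j 1 then 1 else 2.
have c0 j : c j != 0 by rewrite /c; case: ifP.
apply: (@block_graph_iso _ _ _ _ XGamma Xt _ _ _ (fun j a => c j * f a)) => [j | j a b].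
  exists (fun x => g ((c j)^-1 * x)) => x; first by rewrite mulKf ?fK.
  by rewrite gK mulVKf.
rewrite [LHS]C5_relE -mulrBr connectionE /c.
have := pent j; elim/F5_cases: (f b - f a);
  rewrite ?connectionN ?connection0; case: (connection j 1) => // ->; by [].
Qed.
End Pentagon.

(** * Case analysis over the admissible groups *)

Theorem theorem3p9 (m k : nat) (X Y : {set {perm 'I_m}})
  (Gamma : sgraph ('I_m * 'I_k)%type) (G : {group {perm ('I_m * 'I_k)}})
  (HXY : admissible X Y)
  (Htrans : vertex_transitive Gamma)
  (HG : G \subset graph_aut Gamma)
  (HXG : base_power k X \subset G)
  (HGY : G \subset wreath_Sym k Y) :
  (mu_is Gamma 2 /\
     exists (W : finType) (Theta : sgraph W), vertex_transitive Theta /\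
       (graph_iso Gamma (lex_product Theta (complete_graph m)) \/
        graph_iso Gamma (lex_product Theta (edgeless_graph m)))) \/
  (mu_is Gamma 4 /\
     exists (W : finType) (Theta : sgraph W), vertex_transitive Theta /\
       graph_iso Gamma (lex_product Theta C5)).
Proof.
have XGamma := subset_trans HXG HG; have /vertex_transitiveP[[[z j0]] Gt] := Htrans.
(* Settles every case except [D5]: a 2-transitive [X] is transitive and makes every block
   homogeneous. *)
have two_trans : 1 < m -> two_transitive X -> mu_is Gamma 2 /\
    exists (W : finType) (Theta : sgraph W), vertex_transitive Theta /\
    (graph_iso Gamma (lex_product Theta (complete_graph m)) \/
     graph_iso Gamma (lex_product Theta (edgeless_graph m))).
  move=> m1 tX; have other (a : 'I_m) : exists b, a != b.
    by apply: exists_neq; rewrite card_ord.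
  apply: (homogeneous_case XGamma _ z) => // [a b | j].
    have [a' aa'] := other a; have [b' bb'] := other b.
    by have [x xX [xa _]] := tX a a' b b' aa' bb'; exists x.
  have [z' zz'] := other z; exists (Gamma (z, j) (z', j)) => a b ab.
  have [x xX [<- <-]] := tX a b z z' ab zz'.
  by rewrite (inner_adj XGamma).
case: HXY => [m4 XA _ | m5 [f [fbij XD _]] | m6 [f [fbij XA _]]
             | m7 [f [fbij XA _]] | m8 [f [fbij XA _]]].
- by left; apply: two_trans; [exact: leq_trans m4 | rewrite XA; exact: two_transitive_Alt].
- case: (fbij) => g fK gK; rewrite {}XD in XGamma.
  have [/existsP[j /eqP hj] | no_hom] :=
    boolP [exists j, connection g Gamma j 2%R == connection g Gamma j 1%R].
    left; apply: (homogeneous_case XGamma (pullback_D5_trans fK gK) z); rewrite ?m5 // => i.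
    have hom_j : homogeneous Gamma j.
      by have [//|] := homogeneous_or_pentagon fK gK XGamma j; rewrite hj; case: connection.
    have [//| pi] := homogeneous_or_pentagon fK gK XGamma i.
    (* A single homogeneous block [j] rules out pentagons: [h] carries a twin of [(z, j)] to a twin
       of [(z, i)], which a pentagon does not admit. *)
    have [h hA hz] := Gt (z, j) (z, i).
    have [z' zz'] : exists z', z != z' by apply: exists_neq; rewrite card_ord m5.
    have := twins_aut hA (homogeneous_twins XGamma (pullback_D5_trans fK gK) hom_j zz').
    by rewrite hz => /(pentagon_no_twins fK gK XGamma pi); case.
  right; apply: (pentagon_case fK gK XGamma Htrans) => j.
  have := no_hom; rewrite negb_exists => /forallP/(_ j).
  by case: (connection g Gamma j 2%R) (connection g Gamma j 1%R) => [] [].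
- left; apply: two_trans; rewrite ?m6 // XA.
  exact: two_transitive_pullback fbij (@two_transitive_PSL2 _).
- left; apply: two_trans; rewrite ?m7 // XA.
  exact: two_transitive_pullback fbij (@two_transitive_PGL _ _).
- left; apply: two_trans; rewrite ?m8 // XA.
  exact: two_transitive_pullback fbij (@two_transitive_AGL _ _).
Qed.
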